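(* Let $k$ be a non-negative integer and let $m,\alpha,\beta\ge 1$ be integers with $2\nmid\alpha$. Let $p\ge 3$ be a prime such that $p\equiv 3\pmod 4$. Then for all integers $n\ge 0$, $$\bar a_{2^m\alpha}\left(4p^{2k}n+p^{2k}\right)\equiv (p^2)^k\,\bar a_{2^m\alpha}(4n+1)\pmod{2^{m+2}},$$ $$\bar a_{2\beta+1}\left(4p^{2k}n+p^{2k}\right)\equiv (p^2)^k\,\bar a_{2\beta+1}(4n+1)\pmod 4.$$
   Context: For integers $\ell\ge1$ write $f_\ell=\prod_{j\ge 1}(1-q^{\ell j})$. For a positive integer $s$, $\bar a_s(n)$ denotes the number of partitions of $n$ in which each odd part occurs in one of $s$ colors and the first occurrence of each part (parts of the same size but different colors being distinct) may be overlined. Equivalently, $$\sum_{n\ge0}\bar a_s(n)q^n=\frac{f_2^{3s-2}}{f_1^{2s}f_4^{s-1}}.$$ *)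

(* Defs.v *)
From mathcomp Require Import all_boot.

Set Implicit Arguments.
Unset Strict Implicit.
Unset Printing Implicit Defensive.

(* The element (i; c) stands for a part of size i.+1 in colour c: there are s
   colours when the size is odd, and one otherwise. *)
Definition cpart (s n : nat) : finType :=
  {i : 'I_n & 'I_(if odd i.+1 then s else 1)}.

Definition psize (s n : nat) (c : cpart s n) : nat := (tag c).+1.

(* A pair (mu, O) is a partition given by its multiplicities mu, together with
   the set O of those coloured parts whose first occurrence is overlined.
   Bounding the part sizes and the multiplicities by n loses nothing for
   partitions of n. *)
Definition coverpartitions (s n : nat) :
    {set {ffun cpart s n -> 'I_n.+1} * {set cpart s n}} :=
  [set x : {ffun cpart s n -> 'I_n.+1} * {set cpart s n} |
    (\sum_(c : cpart s n) psize c * x.1 c == n)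
    && (x.2 \subset [set c | 0 < x.1 c])].

Definition abar (s n : nat) : nat := #|coverpartitions s n|.

(* Main.v *)
(* The generating function of abar s is the product over all parts i of
   ((1+q^i)/(1-q^i))^c = (1 + 2 E_i)^c, where E_i = q^i + q^(2i) + ... and c is
   the number of colours, s for odd i and 1 for even i.  If s = 2^m a with a
   odd, then modulo 2^(m+2) the factor of an odd i is
   1 + 2^(m+1) (E_i + f^2) for some f, so the product over odd i is
   1 + 2^(m+1) sum_i (E_i + f_i^2); modulo 2 a square has only even
   exponents.  The product over even i is 1 modulo 2 and has only even
   exponents.  Hence for odd n, abar s n = 2^(m+1) d(n) modulo 2^(m+2), where
   d is the number of divisors, and d(n) is odd exactly when n is a square.
   Squareness does not change under multiplication by p^(2k); the second
   congruence is the case m = 0. *)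
Require Import Defs.
From mathcomp Require Import all_boot.
From mathcomp Require Import all_algebra ring zify.

Import GRing.Theory.

Lemma prod_1Dmul_nilp (R : comNzRingType) (I : finType) (P : pred I) (c : R)
    (t : I -> R) :
  (c * c = 0 -> \prod_(i | P i) (1 + c * t i) = 1 + c * \sum_(i | P i) t i)%R.
Proof.
move=> cc0; apply: (big_rec2 (fun x y => x = 1 + c * y)%R) => [|i x y _ ->].
  by rewrite mulr0 addr0.
have -> : ((1 + c * t i) * (1 + c * y)
           = 1 + c * (t i + y) + c * c * (t i * y))%R by ring.
by rewrite cc0 mul0r addr0.
Qed.

(** The square of [1 + c * t] is 1, so only the parity of the exponent matters. *)
Lemma expr_1Dmul_odd (R : comNzRingType) (c t : R) (a : nat) :
  (c * c = 0 -> c *+ 2 = 0 -> odd a -> (1 + c * t) ^+ a = 1 + c * t)%R.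
Proof.
move=> cc0 c20 odd_a; rewrite -[a]odd_double_half odd_a exprD expr1 -mul2n exprM.
have -> : ((1 + c * t) ^+ 2 = 1 + (c *+ 2) * t + c * c * (t * t))%R by ring.
by rewrite c20 cc0 !mul0r !addr0 expr1n mulr1.
Qed.

(** Repeated squaring. The first one gives 1 + 4(e + e^2), whence [f = e]; a later one turns 1 +
    2^(m+2) y into 1 + 2^(m+3) (y + 2^(m+1) y^2), which changes only [w]. *)
Lemma expr_1Dmul2_exp2 (R : comNzRingType) (e : R) (m : nat) :
  exists f w : R,
    ((1 + e *+ 2) ^+ (2 ^ m) = 1 + 2%:R ^+ m.+1 * (e + f ^+ 2 + w *+ 2))%R.
Proof.
elim: m => [|[|m] [f [w IHm]]].
- by exists 0%R, 0%R; rewrite expn0; ring.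
- by exists e, 0%R; rewrite expn1; ring.
set y := (e + f ^+ 2 + w *+ 2)%R in IHm.
exists f, (w + 2%:R ^+ m * y ^+ 2)%R.
by rewrite expnSr exprM {}IHm /y !exprS; ring.
Qed.

(** Since 2c = 0, the map p -> c p^2 is additive, so c f^2 is the sum of the images of the monomials
    of f, whose exponents are even. *)
Lemma coef_sqr_odd (R : comNzRingType) (c : R) (f : {poly R}) (k : nat) :
  (c *+ 2 = 0)%R -> odd k -> (c * (f ^+ 2)`_k = 0)%R.
Proof.
move=> c20 odd_k; rewrite -coefCM.
have sqrD : {morph (fun p : {poly R} => c%:P * p ^+ 2)%R : x y / (x + y)%R}.
  move=> x y; rewrite /=.
  have -> : (c%:P * (x + y) ^+ 2
             = c%:P * x ^+ 2 + c%:P * y ^+ 2 + (c%:P *+ 2) * (x * y))%R by ring.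
  by rewrite -polyCMn c20 polyC0 mul0r addr0.
rewrite -[f]coefK poly_def (big_morph _ sqrD (_ : _ = 0%R)) ?expr0n ?mulr0 //.
rewrite coef_sum big1 // => i _.
rewrite coefCM exprZn -exprM coefZ coefXn.
by case: eqP => [k_eq|_]; [move: odd_k; rewrite k_eq; lia | rewrite !mulr0].
Qed.

Lemma coef_prod_even (R : comNzRingType) (I : finType) (P : pred I)
    (F : I -> {poly R}) :
  (forall i, P i -> forall k, odd k -> (F i)`_k = 0)%R ->
  forall k, odd k -> ((\prod_(i | P i) F i)`_k = 0)%R.
Proof.
move=> F0; apply: (big_ind (fun q : {poly R} => forall k, odd k -> q`_k = 0)%R) => //.
  by move=> [|k] // _; rewrite coef1.
move=> p q p0 q0 k odd_k; rewrite coefM big1 // => -[j le_jk] _ /=.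
case odd_j: (odd j); first by rewrite p0 ?mul0r.
by rewrite q0 ?mulr0 // oddB ?odd_k ?odd_j.
Qed.

(* E_d, truncated at r = n, which does not affect the coefficient of 'X^n. *)
Definition multiples (R : comNzRingType) (n d : nat) : {poly R} :=
  (\sum_(r < n) 'X^(d * r.+1))%R.

(** Expanding the product chooses a multiplicity for each coloured part. Each nonzero multiplicity
    brings a factor 2, and the resulting power of 2 counts the sets of overlined parts. *)
Lemma abarE (R : comNzRingType) (s n : nat) :
  ((abar s n)%:R
   = (\prod_(c : cpart s n) (1 + multiples R n (psize c) *+ 2))`_n)%R.
Proof.
transitivity ((\sum_(c : {ffun cpart s n -> 'I_n.+1})
   'X^(\sum_d psize d * c d) *+ 2 ^ (\sum_d (0 < c d)%N) : {poly R})`_n)%R; last first.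
  congr ((_ : {poly R})`_n)%R.
  rewrite (eq_bigr (fun d => \sum_(r < n.+1) 'X^(psize d * r) *+ 2 ^ (0 < r)%N)%R).
    rewrite bigA_distr_bigA; apply: eq_bigr => mu _.
    by rewrite prodrMn prodrXr expn_sum.
  move=> d _; rewrite big_ord_recl /= muln0 expr0 mulr1n.
  by congr (_ + _)%R; rewrite /multiples -sumrMnl; apply: eq_bigr.
rewrite coef_sum.
under [RHS]eq_bigr => mu _ do rewrite coefMn coefXn -mulrnA.
rewrite -natr_sum; congr (_%:R)%R; rewrite /abar -sum1_card.
transitivity (\sum_(mu : {ffun cpart s n -> 'I_n.+1}
                   | \sum_c psize c * mu c == n)
     \sum_(O : {set cpart s n} | O \subset [set c | 0 < mu c]) 1).
  by rewrite pair_big_dep; apply: eq_bigl => x; rewrite inE.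
rewrite big_mkcond; apply: eq_bigr => mu _; rewrite eq_sym.
case: eqP => _; rewrite ?mul0n ?mul1n //.
transitivity #|powerset [set c | 0 < mu c]|.
  by rewrite -sum1_card; apply: eq_bigl => O; rewrite powersetE.
rewrite card_powerset -sum1_card; congr (2 ^ _).
by rewrite big_mkcond; apply: eq_bigr => c _; rewrite inE; case: ltnP.
Qed.

Lemma coef_multiples (R : comNzRingType) (n d k : nat) :
  ((multiples R n d)`_k = (\sum_(r < n) (d * r.+1 == k))%:R)%R.
Proof.
rewrite coef_sum natr_sum; apply: eq_bigr => r _.
by rewrite coefXn eq_sym.
Qed.

Lemma abar_mod (m a n : nat) : odd a -> odd n ->
  abar (2 ^ m * a) n
    = 2 ^ m.+1 * \sum_(i < n) \sum_(r < n) (i.+1 * r.+1 == n) %[mod 2 ^ m.+2].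
Proof.
move=> odd_a odd_n; pose A := 'Z_(2 ^ m.+2).
have M_gt1 : 1 < 2 ^ m.+2 by rewrite -{1}(expn0 2) ltn_exp2l.
(* This [c] annihilates 2 and has square zero, so products of factors 1 + c t become linear in the
   t. *)
pose c : A := ((2 ^ m.+1)%:R)%R.
have c20 : (c *+ 2 = 0)%R by rewrite -mulr_natr -natrM -expnSr pchar_Zp.
have cc0 : (c * c = 0)%R.
  by rewrite -natrM -expnD addnS -addSn expnD natrM pchar_Zp ?mul0r.
suff: ((abar (2 ^ m * a) n)%:R
       = c * (\sum_(i < n) \sum_(r < n) (i.+1 * r.+1 == n))%:R :> A)%R.
  rewrite -natrM => /(congr1 val).
  by rewrite /= !val_Zp_nat.
have C20 : (c%:P *+ 2 = 0 :> {poly A})%R by rewrite -polyCMn c20.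
have CC0 : (c%:P * c%:P = 0 :> {poly A})%R by rewrite -polyCM cc0.
rewrite abarE; pose E d := multiples A n d.
rewrite -(@sig_big_dep _ _ _ _ (fun i : 'I_n => 'I_(if odd i.+1 then 2 ^ m * a else 1))
  xpredT (fun _ => xpredT) (fun i _ => 1 + E i.+1 *+ 2)%R) /=.
under eq_bigr => i _ do rewrite prodr_const card_ord.
rewrite (bigID (fun i : 'I_n => odd i.+1)) /=.
(* The target is the coefficient at n of (1 + c S) Q, with S a sum over odd sizes. The term Q
   vanishes at the odd index n, and c S Q = c S because Q is 1 modulo 2. *)
set Q := (X in (_ * X)%R).
have E_even (d k : nat) : ~~ odd d -> odd k -> ((E d)`_k = 0)%R.
  move=> even_d odd_k; rewrite coef_multiples big1 // => r _.
  by case: eqP odd_k => // <-; rewrite oddM (negbTE even_d).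
have Q_odd : (Q`_n = 0)%R.
  apply: coef_prod_even odd_n => i even_i k odd_k.
  rewrite (negbTE even_i) expr1 coefD coefMn E_even // mul0rn addr0 coef1.
  by case: k odd_k.
have cQ : (c%:P * Q = c%:P)%R.
  apply: (big_ind (fun q => c%:P * q = c%:P)%R) => [|x y cx cy|i even_i].
  - by rewrite mulr1.
  - by rewrite mulrA cx.
  - by rewrite (negbTE even_i) expr1 mulrDr mulr1 mulrnAr -mulrnAl C20 mul0r addr0.
(* At the odd index n the square f^2 contributes nothing, and c kills 2w, so only the coefficient of
   [E i.+1] survives. *)
have /fin_all_exists2 [T expE coefT] (i : 'I_n) : exists2 t : {poly A},
    ((1 + E i.+1 *+ 2) ^+ (2 ^ m * a) = 1 + c%:P * t)%R
  & ((c%:P * t)`_n = c * (E i.+1)`_n)%R.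
  have [f [w expE]] := expr_1Dmul2_exp2 _ (E i.+1) m.
  exists (E i.+1 + f ^+ 2 + w *+ 2)%R.
    by rewrite exprM expE -natrX -polyC_natr expr_1Dmul_odd.
  rewrite mulrDr mulrnAr -mulrnAl C20 mul0r addr0 coefCM coefD mulrDr.
  by rewrite (coef_sqr_odd _ _ _ _ c20 odd_n) addr0.
rewrite (eq_bigr (fun i => 1 + c%:P * T i)%R) => [|i odd_i]; last first.
  by rewrite odd_i expE.
rewrite prod_1Dmul_nilp // mulrDl mul1r mulrAC cQ coefD Q_odd add0r.
rewrite mulr_sumr coef_sum.
rewrite (eq_bigr _ (fun i _ => coefT i)).
rewrite natr_sum mulr_sumr [RHS](bigID (fun i : 'I_n => odd i.+1)) /=.
(* An even number does not divide the odd n, so the even sizes add nothing to the divisor count. *)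
rewrite [X in (_ + X)%R]big1 => [|i even_i]; last first.
  by rewrite -coef_multiples E_even ?mulr0.
by rewrite addr0; apply: eq_bigr => i _; rewrite coef_multiples.
Qed.

(** Off-diagonal terms cancel in pairs: each induction step adds a row, an equal column and one
    diagonal term. *)
Lemma sum_sym_mod2 (n : nat) (F : nat -> nat -> nat) :
  (forall i j, F i j = F j i) ->
  \sum_(i < n) \sum_(j < n) F i j = \sum_(i < n) F i i %[mod 2].
Proof.
move=> FC; elim: n => [|n IHn]; first by rewrite !big_ord0.
rewrite !big_ord_recr /=.
under eq_bigr => i _ do rewrite big_ord_recr /=.
rewrite big_split /=.
have -> : \sum_(i < n) F i n = \sum_(j < n) F n j by apply: eq_bigr.
move: IHn; move: (\sum_(i < n) \sum_(j < n) F i j) (\sum_(i < n) F i i) => x y.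
by move: (\sum_(j < n) F n j) => z; lia.
Qed.

Lemma odd_ndivisors (n : nat) : 0 < n ->
  odd (\sum_(i < n) \sum_(r < n) (i.+1 * r.+1 == n))
  = [exists a : 'I_n.+1, a ^ 2 == n].
Proof.
move=> n_gt0.
have -> : odd (\sum_(i < n) \sum_(r < n) (i.+1 * r.+1 == n))
          = odd (\sum_(i < n) (i.+1 ^ 2 == n)).
  have := sum_sym_mod2 n (fun i j => i.+1 * j.+1 == n)
    (fun i j => congr1 (fun x => (x == n) : nat) (mulnC i.+1 j.+1)).
  by rewrite /= !modn2 => /(congr1 odd); rewrite !oddb.
case: existsP => [[a /eqP aa]|noroot]; last first.
  rewrite big1 // => i _; case: eqP => // ii; case: noroot.
  by exists (lift ord0 i); apply/eqP.
have a_gt0 : 0 < a by case: (val a) aa n_gt0 => // <-.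
(* The index i stands for the divisor i + 1, so the root a sits at index a - 1. *)
have lt_a : a.-1 < n by rewrite prednK // -ltnS.
rewrite (bigD1 (Ordinal lt_a)) //= prednK // aa eqxx big1 // => i ne_i.
apply/eqP; rewrite eqb0; apply: contra ne_i => /eqP ii.
apply/eqP/val_inj => /=; apply: succn_inj; rewrite prednK //.
by apply/eqP; rewrite -(eqn_exp2r _ _ (isT : 0 < 2)) ii aa.
Qed.

Lemma odd_ndivisors_mul_sqr (b n : nat) : 0 < b -> 0 < n ->
  odd (\sum_(i < b ^ 2 * n) \sum_(r < b ^ 2 * n) (i.+1 * r.+1 == b ^ 2 * n))
  = odd (\sum_(i < n) \sum_(r < n) (i.+1 * r.+1 == n)).
Proof.
move=> b_gt0 n_gt0; have bb_gt0 : 0 < b ^ 2 by rewrite expn_gt0 b_gt0.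
rewrite !odd_ndivisors ?muln_gt0 ?b_gt0 //.
have sq x : x <= x ^ 2 by rewrite -mulnn; nia.
apply/existsP/existsP => -[a /eqP aa]; last first.
  have le_ba : b * a < (b ^ 2 * n).+1 by rewrite ltnS (leq_trans (sq _)) // expnMn aa.
  by exists (Ordinal le_ba); rewrite /= expnMn aa.
(* From a^2 = b^2 n, b^2 divides a^2, hence b divides a, and a / b is a root of n. *)
have /dvdnP[d ad] : b %| a by rewrite -(dvdn_pexp2r _ _ (isT : 0 < 2)) aa dvdn_mulr.
have dd : d ^ 2 = n by apply/eqP; rewrite -(eqn_pmul2l bb_gt0) -aa ad expnMn mulnC.
have le_d : d < n.+1 by rewrite ltnS -dd.
by exists (Ordinal le_d); rewrite /= dd.
Qed.

(** Both sides are 2^(m+1) times an integer, so modulo 2^(m+2) only the parities of these integers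
    count, and the odd factor b^2 does not affect them. *)
Lemma abar_mul_sqr (m a b n : nat) : odd a -> odd b -> odd n ->
  abar (2 ^ m * a) (b ^ 2 * n) = b ^ 2 * abar (2 ^ m * a) n %[mod 2 ^ m.+2].
Proof.
move=> odd_a odd_b odd_n.
have [b_gt0 n_gt0] : 0 < b /\ 0 < n by rewrite !odd_gt0.
rewrite -[RHS]modnMmr !abar_mod ?oddM ?oddX ?odd_b // modnMmr.
have := odd_ndivisors_mul_sqr _ _ b_gt0 n_gt0.
move: (\sum_(i < b ^ 2 * n) _) (\sum_(i < n) _) => x y odd_xy.
rewrite mulnCA [2 ^ m.+2]expnSr -!muln_modr; congr (_ * _).
by rewrite !modn2 oddM oddX odd_b odd_xy.
Qed.

Theorem corollary1p5 (k m alpha beta p : nat)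
    (hm : 1 <= m) (halpha : 1 <= alpha) (hbeta : 1 <= beta)
    (halpha_odd : ~~ (2 %| alpha))
    (hp3 : 3 <= p) (hp : prime p) (hp4 : p = 3 %[mod 4]) (n : nat) :
  abar (2 ^ m * alpha) (4 * p ^ (2 * k) * n + p ^ (2 * k))
    = (p ^ 2) ^ k * abar (2 ^ m * alpha) (4 * n + 1) %[mod 2 ^ (m + 2)]
  /\
  abar (2 * beta + 1) (4 * p ^ (2 * k) * n + p ^ (2 * k))
    = (p ^ 2) ^ k * abar (2 * beta + 1) (4 * n + 1) %[mod 4].
Proof.
have odd_pk : odd (p ^ k) by rewrite oddX; lia.
have odd_n : odd (4 * n + 1) by lia.
have -> : 4 * p ^ (2 * k) * n + p ^ (2 * k) = (p ^ k) ^ 2 * (4 * n + 1).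
  by rewrite -expnM mulnC [2 * k]mulnC; ring.
rewrite -[(p ^ 2) ^ k]expnM (mulnC 2) expnM addn2; split.
  by apply: abar_mul_sqr => //; rewrite -[odd _]negbK -dvdn2.
have odd_s : odd (2 * beta + 1) by lia.
(* With m = 0 the number of colours is the odd number itself and the modulus is 2^2. *)
by have := abar_mul_sqr 0 _ _ _ odd_s odd_pk odd_n; rewrite mul1n.
Qed.
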